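(* Let $\mathcal{T}$ be a weakly compatible conforming triangulation of a domain $\Omega\subset\mathbb{R}^d$ ($d\ge2$) into finitely many $d$-simplices, and let $\mathcal{M}\subset\mathcal{T}$ be any set of elements marked for refinement. Then the iterative NVB refinement algorithm applied to $\mathcal{T}$ and $\mathcal{M}$ terminates.
   Context: Newest Vertex Bisection (NVB). A $d$-simplex is given with an ordering of its vertices and a type $t\in\{0,\dots,d-1\}$, written $T=[z_0,z_1,\dots,z_d]_t$. Its refinement edge is $\overline{z_0z_d}$, and bisecting it produces the two children $$T_0=\left[z_0,\tfrac{z_0+z_d}{2},z_1,\dots,z_{d-1}\right]_{(t+1)\bmod d},\qquad T_1=\left[z_d,\tfrac{z_0+z_d}{2},z_1,\dots,z_t,z_{d-1},\dots,z_{t+1}\right]_{(t+1)\bmod d}.$$ Iterative NVB refinement algorithm. Input: a conforming triangulation $\mathcal{T}$ (each element with an ordering and type) and a set $\mathcal{M}\subset\mathcal{T}$. While $\mathcal{M}\neq\emptyset$: replace each element of $\mathcal{M}$ in the current partition by its two NVB children, and then let $\mathcal{M}$ be the set of those elements $T$ of the new partition that contain a hanging node, i.e. a vertex of the partition that lies in $T$ but is not a vertex of $T$. The algorithm terminates when $\mathcal{M}=\emptyset$, i.e. when the partition is conforming. Refinement tree and NVB-equivalence. For a $d$-simplex $T$ with ordering and type, the refinement tree $\mathcal{RT}(T)$ is the rooted binary tree obtained from $d$ uniform NVB refinements of $T$ (each uniform refinement bisects all current descendants): its nodes are the refinement edges of $T$ and of its descendants, the root is the refinement edge of $T$, and the (unordered)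 two children of a node are the refinement edges of the two children of the corresponding simplex. It has levels $0,\dots,d-1$. Two $d$-simplices (same vertex set, possibly different ordering/type) are NVB-equivalent if their refinement trees coincide. Induced refinement of a face. If $F$ is a $(d-1)$-dimensional subsimplex of $T$, successive uniform NVB refinements of $T$ induce successive bisections of $F$ (a piece of $F$ is bisected whenever the refinement edge of the descendant of $T$ having that piece as a face lies in that piece). An ordering and type of $F$ (as a $(d-1)$-dimensional NVB simplex) is the ordering and type of $F$ within $T$ if this induced refinement is the NVB refinement of $F$ with that ordering and type; it is considered only up to NVB-equivalence. Conforming: the intersection of any two distinct elements is empty or a common subsimplex of both. Weakest compatibility condition: a triangulation $\mathcal{T}$ (each element with an ordering and type) satisfies it iff for any two neighbors $T,T'\in\mathcal{T}$ with shared $(d-1)$-face $F=T\cap T'$, the ordering and type of $F$ within $T$ and within $T'$ coincide up to NVB-equivalence. Weakly compatible: $\mathcal{T}$ satisfies the weakest compatibility condition and there exists a finer triangulation (obtained from $\mathcal{T}$ by finitely many NVB bisections of elements) that is conforming and contains only elements of type $0$ or $1$. *)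

(* Defs.v *)
From HB Require Import structures.
From mathcomp Require Import all_boot all_order all_algebra.
From mathcomp Require Import all_classical all_reals topology normedtype.

Set Implicit Arguments.
Unset Strict Implicit.
Unset Printing Implicit Defensive.

Import Order.TTheory GRing.Theory Num.Theory.
Import numFieldNormedType.Exports.
Local Open Scope classical_set_scope.
Local Open Scope ring_scope.

Section Geometry.
Context {R : realType} {m : nat}.
Local Notation point := 'rV[R]_m.

Definition conv_hull (s : seq point) : set point :=
  [set x | exists l : 'I_(size s) -> R,
     [/\ forall i, 0 <= l i, \sum_i l i = 1 & x = \sum_i l i *: s`_i]].

Definition affinely_independent (s : seq point) : bool :=
  free [seq z - head 0 s | z <- behead s].

Definition midpoint (x y : point) : point := 2^-1 *: (x + y).

End Geometry.

Definition domain {R : realType} {m : nat} (Omega : set 'rV[R]_m) : Prop :=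
  [/\ open Omega, connected Omega & Omega !=set0].

(* [z_0, ..., z_k]_t in R^m.  Nondegeneracy is not part of the record. *)
Record nvb_simplex (R : realType) (m k : nat) := NVBSimplex {
  vert : k.+1.-tuple 'rV[R]_m;
  simplex_type : 'I_k
}.

Section Bisection.
Context {R : realType} {m k : nat}.
Implicit Types T : nvb_simplex R m k.

Definition vset T : set 'rV[R]_m := [set x | x \in vert T].

Definition vfirst T : 'rV[R]_m := tnth (vert T) ord0.
Definition vlast T : 'rV[R]_m := tnth (vert T) ord_max.
Definition vmid T : 'rV[R]_m := midpoint (vfirst T) (vlast T).

(* z_1, ..., z_(k-1) *)
Definition inner T : seq 'rV[R]_m := behead (take k (vert T)).

Definition ref_edge T : set 'rV[R]_m := [set vfirst T; vlast T].

Lemma size_inner T : (size (inner T)).+2 = k.+1.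
Proof.
rewrite size_behead size_takel ?size_tuple //.
by case: T => _; case: k => [[]|].
Qed.

Lemma size_child0 T : size [:: vfirst T, vmid T & inner T] == k.+1.
Proof. exact/eqP/size_inner. Qed.

Lemma size_child1 T :
  size [:: vlast T, vmid T
         & take (simplex_type T) (inner T) ++ rev (drop (simplex_type T) (inner T))] == k.+1.
Proof. by rewrite /= size_cat size_rev -size_cat cat_take_drop size_inner. Qed.

(* ordS t is (t + 1) mod k in 'I_k *)
Definition child0 T := NVBSimplex (Tuple (size_child0 T)) (ordS (simplex_type T)).
Definition child1 T := NVBSimplex (Tuple (size_child1 T)) (ordS (simplex_type T)).

Definition children T : set (nvb_simplex R m k) := [set child0 T; child1 T].

End Bisection.

Inductive btree (A : Type) : Type :=
| Leaf
| Node of A & btree A & btree A.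
Arguments Leaf {A}.

(* Equality of rooted trees whose two children are unordered. *)
Fixpoint btree_eqv (A : Type) (s t : btree A) : Prop :=
  match s, t with
  | Leaf, Leaf => True
  | Node a s0 s1, Node b t0 t1 =>
      a = b /\ ((btree_eqv s0 t0 /\ btree_eqv s1 t1)
                \/ (btree_eqv s0 t1 /\ btree_eqv s1 t0))
  | _, _ => False
  end.

Section RefinementTree.
Context {R : realType} {m k : nat}.
Implicit Types S T : nvb_simplex R m k.

(* Levels 0, ..., n-1 of the refinement edges under uniform refinement. *)
Fixpoint edge_tree (n : nat) T : btree (set 'rV[R]_m) :=
  if n is n'.+1
  then Node (ref_edge T) (edge_tree n' (child0 T)) (edge_tree n' (child1 T))
  else Leaf.

Definition refinement_tree T := edge_tree k T.

Definition nvb_equivalent S T : Prop :=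
  vset S = vset T /\ btree_eqv (refinement_tree S) (refinement_tree T).

(* Levels 0, ..., n-1 of the descendants (as vertex sets) under uniform
   refinement. *)
Fixpoint piece_tree (n : nat) T : btree (set 'rV[R]_m) :=
  if n is n'.+1
  then Node (vset T) (piece_tree n' (child0 T)) (piece_tree n' (child1 T))
  else Leaf.

End RefinementTree.

(* induced_tree n T P t: under uniform refinement of T, the face of T with
   vertex set P undergoes successive bisections whose pieces form, on levels
   0, ..., n-1, the tree t.  If the refinement edge of T does not lie in P, then
   P is still a face of a child of T and remains whole; otherwise it is cut at
   the midpoint, into the parts contained in child0 T and child1 T. *)
Inductive induced_tree {R : realType} {m k : nat} :
  nat -> nvb_simplex R m k -> set 'rV[R]_m -> btree (set 'rV[R]_m) -> Prop :=
| InducedNone T P : induced_tree 0 T P Leaf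
| InducedSkip n T T' P t :
    ~ (ref_edge T `<=` P) -> children T T' -> P `<=` vset T' ->
    induced_tree n T' P t -> induced_tree n T P t
| InducedBisect n T P t0 t1 :
    ref_edge T `<=` P ->
    induced_tree n (child0 T) ((vmid T |` P) `&` vset (child0 T)) t0 ->
    induced_tree n (child1 T) ((vmid T |` P) `&` vset (child1 T)) t1 ->
    induced_tree n.+1 T P (Node P t0 t1).

(* S carries the ordering and type within T of the face with vertex set
   vset S. *)
Definition ordering_type_within {R : realType} {m k : nat}
    (T : nvb_simplex R m k) (S : nvb_simplex R m k.-1) : Prop :=
  vset S `<=` vset T /\
  forall n, exists2 t, induced_tree n T (vset S) t
                     & btree_eqv t (piece_tree n S).

Section Triangulation.
Context {R : realType} {d : nat}.
Local Notation simplex := (nvb_simplex R d d).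
Implicit Types (T : simplex) (P M : set simplex).

Definition triangulation (Omega : set 'rV[R]_d) P : Prop :=
  [/\ finite_set P,
      forall T, P T -> affinely_independent (vert T),
      forall T T', P T -> P T' -> T <> T' ->
        (conv_hull (vert T))° `&` (conv_hull (vert T'))° = set0
    & \bigcup_(T in P) conv_hull (vert T) = closure Omega].

Definition common_subsimplex T T' (F : seq 'rV[R]_d) : Prop :=
  [/\ uniq F, {subset F <= vert T}, {subset F <= vert T'}
    & conv_hull (vert T) `&` conv_hull (vert T') = conv_hull F].

Definition conforming P : Prop :=
  forall T T', P T -> P T' -> T <> T' ->
    conv_hull (vert T) `&` conv_hull (vert T') = set0
    \/ exists F, common_subsimplex T T' F.

Definition weakest_compatibility P : Prop :=
  forall T T' (F : seq 'rV[R]_d), P T -> P T' -> T <> T' ->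
    size F = d -> common_subsimplex T T' F ->
    exists S S' : nvb_simplex R d d.-1,
      [/\ vset S = [set x | x \in F] /\ vset S' = [set x | x \in F],
          ordering_type_within T S, ordering_type_within T' S'
        & nvb_equivalent S S'].

Definition bisect P M : set simplex :=
  (P `\` M) `|` \bigcup_(T in M) children T.

Inductive nvb_refinement P : set simplex -> Prop :=
| RefineNone : nvb_refinement P P
| RefineStep Q T :
    nvb_refinement P Q -> Q T -> nvb_refinement P (bisect Q [set T]).

Definition weakly_compatible P : Prop :=
  weakest_compatibility P /\
  exists Q, [/\ nvb_refinement P Q, conforming Q
              & forall T, Q T -> (simplex_type T <= 1)%N].

Definition has_hanging_node P T : Prop :=
  exists v, [/\ exists2 T', P T' & vset T' v,
                conv_hull (vert T) v & ~ vset T v].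

(* One pass of the loop, on the pair (partition, marked elements). *)
Definition nvb_step (s : set simplex * set simplex) :=
  let P := bisect s.1 s.2 in (P, [set T | P T /\ has_hanging_node P T]).

Definition iterative_nvb_terminates P M : Prop :=
  exists n, (iter n nvb_step (P, M)).2 = set0.

End Triangulation.

(* Main.v *)
(* Bisecting all elements of the conforming refinement Q of types 0 and 1 d
   times bisects every edge of Q exactly once.  The resulting partition U has no
   hanging nodes: its vertices are the vertices and edge midpoints of Q, and
   inside one element S of Q these half-lattice points meet a d-th descendant of
   S only in its vertices, because that descendant is unimodular for the half
   lattice.  Every loop of the algorithm keeps a partition from which U can be
   reached by further bisections: its nodes are vertices of U, so no element of
   U contains a hanging node and marked elements still have to be bisected on
   the way to U.  Hence the number of bisections missing to reach U decreases.
   Only the refinement Q in the definition of weak compatibility matters,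
   because the loop stops as soon as there are no hanging nodes. *)
Require Import Defs.
From mathcomp Require Import all_boot all_order all_algebra.
From mathcomp Require Import lra.
From mathcomp Require Import all_classical all_reals topology normedtype.

Set Implicit Arguments.
Unset Strict Implicit.
Unset Printing Implicit Defensive.

Import Order.TTheory GRing.Theory Num.Theory.
Local Open Scope classical_set_scope.
Local Open Scope ring_scope.

(** * Half-lattice points of a simplex *)

Section AffineGeometry.
Context {R : realType} {m : nat}.
Local Notation point := 'rV[R]_m.
Implicit Types (s V O N : seq point) (f : point -> R) (x y z v : point).

(** Coordinates are functions on the whole space of which only the values on [s] matter, so
    permuting [s] needs no reindexing. *)
Definition barycentric s f v : Prop :=
  \sum_(z <- s) f z = 1 /\ v = \sum_(z <- s) f z *: z.

(** Affine independence without a distinguished base vertex, hence visibly invariant under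
    permutation. *)
Definition independent s : Prop :=
  uniq s /\ forall f, \sum_(z <- s) f z = 0 -> \sum_(z <- s) f z *: z = 0 ->
    {in s, forall z, f z = 0}.

Lemma affinely_independentP s : affinely_independent s -> independent s.
Proof.
case: s => [|h t] /=; first by move=> _; split.
rewrite /affinely_independent /= => ft.
have ut : uniq t by apply: (map_uniq (free_uniq ft)).
have ht : h \notin t.
  apply/negP => ht; have := free_not0 ft (map_f (fun z => z - h) ht).
  by rewrite subrr eqxx.
split; first by rewrite /= ht.
(* The weight of [h] is minus the sum of the others, which leaves a linear relation among the
   differences [z - h]. *)
move=> f; rewrite !big_cons => /eqP; rewrite addr_eq0 => /eqP fh.
rewrite fh scaleNr scaler_suml addrC -sumrB => f0.
have ft0 : {in t, forall z, f z = 0}.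
  move=> z zt.
  have := ft; rewrite -[X in free X]in_tupleE => /freeP /(_ (fun i => f t`_i)) fr.
  have zi : (index z t < size [seq (z - h)%R | z <- t])%N.
    by rewrite size_map index_mem.
  have := fr _ (Ordinal zi); rewrite /= nth_index //; apply.
  rewrite -[RHS]f0 (big_nth 0) big_mkord size_map; apply: eq_bigr => i _.
  by rewrite (nth_map 0) ?scalerBr.
move=> z; rewrite in_cons => /orP[/eqP->|/ft0//].
by rewrite fh big_seq big1 ?oppr0.
Qed.

Lemma barycentric_unique s f g v :
  independent s -> barycentric s f v -> barycentric s g v -> {in s, f =1 g}.
Proof.
move=> [_ ind] [f1 fv] [g1 gv] z zs; apply/eqP; rewrite -subr_eq0; apply/eqP.
apply: (ind (fun z => f z - g z)) zs; first by rewrite sumrB f1 g1 subrr.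
by under eq_bigr do rewrite scalerBl; rewrite sumrB -fv -gv subrr.
Qed.

Lemma perm_independent s s' :
  perm_eq s s' -> independent s -> independent s'.
Proof.
move=> p [u ind]; split; first by rewrite -(perm_uniq p).
move=> f; rewrite -!(perm_big _ p) => f0 fz z; rewrite -(perm_mem p).
exact: ind.
Qed.

Lemma perm_barycentric s s' f v :
  perm_eq s s' -> barycentric s f v -> barycentric s' f v.
Proof. by move=> p; rewrite /barycentric !(perm_big _ p). Qed.

Lemma conv_hullP s v : uniq s ->
  conv_hull s v <-> exists2 f, {in s, forall z, 0 <= f z} & barycentric s f v.
Proof.
move=> us; split.
  move=> [l [l0 l1 ->]].
  (* The default 0 is reached only outside [s], where the index equals [size s]. *)
  pose f z := if insub (index z s) is Some i then l i else 0.
  have fE (i : 'I_(size s)) : f s`_i = l i.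
    by rewrite /f index_uniq // valK.
  exists f; first by move=> z _; rewrite /f; case: insub.
  by split; rewrite (big_nth 0) big_mkord -?l1; apply: eq_bigr => i _; rewrite fE.
move=> [f f0 [f1 ->]]; exists (fun i => f s`_i); split.
- by move=> i; rewrite f0 // mem_nth.
- by rewrite -f1 [RHS](big_nth 0) big_mkord.
- by rewrite (big_nth 0) big_mkord.
Qed.

Lemma conv_hull_sub s s' : uniq s -> uniq s' ->
  {in s', forall z, conv_hull s z} -> conv_hull s' `<=` conv_hull s.
Proof.
move=> us us' sub v /(conv_hullP _ us')[f f0 [f1 fv]].
have /choice[g gP] z : exists g : point -> R, z \in s' ->
    {in s, forall w, 0 <= g w} /\ barycentric s g z.
  have [zs|] := boolP (z \in s'); last by exists (fun=> 0).
  by have /(conv_hullP _ us)[g] := sub z zs; exists g.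
apply/(conv_hullP _ us); exists (fun w => \sum_(z <- s') f z * g z w).
  move=> w ws; rewrite big_seq sumr_ge0 // => z zs.
  by rewrite mulr_ge0 ?f0 //; case: (gP z zs) => ->.
split.
  rewrite exchange_big -[RHS]f1 big_seq [RHS]big_seq; apply: eq_bigr => z zs.
  by rewrite -mulr_sumr; case: (gP z zs) => _ [-> _]; rewrite mulr1.
under eq_bigr do rewrite scaler_suml.
rewrite exchange_big fv big_seq [RHS]big_seq; apply: eq_bigr => z zs.
transitivity (f z *: \sum_(w <- s) g z w *: w).
  by congr (_ *: _); exact: (gP z zs).2.2.
rewrite scaler_sumr.
by apply: eq_bigr => w _; rewrite scalerA.
Qed.

(** * Vertices and edge midpoints in barycentric coordinates *)

Definition half_points V : set point :=
  [set v | exists x y, [/\ x \in V, y \in V & v = midpoint x y]].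

Lemma midpointC x y : midpoint x y = midpoint y x.
Proof. by rewrite /midpoint addrC. Qed.

Lemma midpointxx x : midpoint x x = x.
Proof.
by rewrite /midpoint -mulr2n -scaler_nat scalerA mulVf ?scale1r // pnatr_eq0.
Qed.

Lemma half_points_vertex V x : x \in V -> half_points V x.
Proof. by exists x, x; rewrite midpointxx. Qed.

Lemma sum_indicator s x : uniq s -> x \in s ->
  \sum_(z <- s) (z == x)%:R = 1 :> R.
Proof.
move=> us xs; rewrite (bigD1_seq x) //= eqxx big1 ?addr0 // => z.
by move=> /negPf->.
Qed.

Lemma sum_indicator_scale s x : uniq s -> x \in s ->
  \sum_(z <- s) (z == x)%:R *: z = x :> point.
Proof.
move=> us xs; rewrite (bigD1_seq x) //= eqxx scale1r big1 ?addr0 // => z.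
by move=> /negPf->; rewrite scale0r.
Qed.

Definition midpoint_coord x y z : R := 2^-1 * ((z == x)%:R + (z == y)%:R).

Lemma midpoint_coord_ge0 x y z : 0 <= midpoint_coord x y z.
Proof. by rewrite /midpoint_coord mulr_ge0 ?invr_ge0 ?addr_ge0 ?ler0n. Qed.

Lemma barycentric_midpoint s x y : uniq s -> x \in s -> y \in s ->
  barycentric s (midpoint_coord x y) (midpoint x y).
Proof.
move=> us xs ys; split.
  by rewrite -mulr_sumr big_split /= !sum_indicator // mulVf // pnatr_eq0.
under eq_bigr do rewrite /midpoint_coord -scalerA scalerDl.
by rewrite -scaler_sumr big_split /= !sum_indicator_scale.
Qed.

Lemma half_points_conv_hull V : uniq V -> half_points V `<=` conv_hull V.
Proof.
move=> uV v [x [y [xV yV ->]]]; apply/(conv_hullP _ uV).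
exists (midpoint_coord x y); last exact: barycentric_midpoint.
by move=> z _; exact: midpoint_coord_ge0.
Qed.

(* Extend coordinates by zero to compare them on the larger simplex. *)
Lemma half_points_face V F v : independent V -> uniq F -> {subset F <= V} ->
  half_points V v -> conv_hull F v -> half_points F v.
Proof.
move=> iV uF FV [x [y [xV yV ->]]] /(conv_hullP _ uF)[f _ [f1 fv]].
have uV := iV.1.
have bF : barycentric V (fun z => if z \in F then f z else 0) (midpoint x y).
  have p : perm_eq [seq z <- V | z \in F] F.
    apply: uniq_perm => [||z]; rewrite ?filter_uniq // mem_filter.
    by apply: andb_idr => /FV.
  split; first by rewrite -big_mkcond -big_filter (perm_big _ p).
  rewrite fv -(perm_big _ p) big_filter big_mkcond.
  by apply: eq_bigr => z _; case: ifP; rewrite ?scale0r.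
have E := barycentric_unique iV bF (barycentric_midpoint uV xV yV).
have n0 : 2^-1 != 0 :> R by rewrite invr_eq0 pnatr_eq0.
have inF z : z \in V -> midpoint_coord x y z != 0 -> z \in F.
  by move=> zV; rewrite -(E z zV); case: ifP => // _; rewrite eqxx.
exists x, y; split=> //; apply: inF => //; rewrite mulf_neq0 // eqxx.
  by rewrite -natrD pnatr_eq0.
by rewrite -natrD pnatr_eq0 addn1.
Qed.

(** * The half lattice under bisection *)

Definition good_coord O N f : Prop :=
  {in O, forall z, 2 * f z \is a Num.int} /\ {in N, forall z, f z \is a Num.int}.

(* Think of O as the vertices of a subsimplex that are vertices of V and
   of N as its vertices that are edge midpoints of V: all vertices and edge
   midpoints of V lie in the lattice spanned by halves of O and by N. *)
Definition good_pair V O N : Prop :=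
  [/\ independent (O ++ N), {subset O <= V}, {in N, forall z, half_points V z}
    & forall v, half_points V v ->
        exists2 f, barycentric (O ++ N) f v & good_coord O N f].

Lemma good_pair_perm V O O' N N' : perm_eq O O' -> perm_eq N N' ->
  good_pair V O N -> good_pair V O' N'.
Proof.
move=> p q [i s h c]; have pq : perm_eq (O ++ N) (O' ++ N') by exact: perm_cat.
split.
- exact: perm_independent i.
- by move=> z; rewrite -(perm_mem p); exact: s.
- by move=> z; rewrite -(perm_mem q); exact: h.
- move=> v /c[f bf [f1 f2]]; exists f; first exact: perm_barycentric bf.
  by split=> z; rewrite -?(perm_mem p) -?(perm_mem q); [exact: f1|exact: f2].
Qed.

Lemma good_pair_refl V : independent V -> good_pair V V [::].
Proof.
move=> iV; split=> //; first by rewrite cats0.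
move=> v [x [y [xV yV ->]]]; exists (midpoint_coord x y).
  by rewrite cats0; apply: barycentric_midpoint => //; case: iV.
split=> // z _; rewrite /midpoint_coord mulrA divff ?mul1r ?pnatr_eq0 //.
by rewrite -natrD natr_int.
Qed.

Lemma midpoint_notin x y s : independent [:: x, y & s] ->
  midpoint x y \notin [:: x, y & s].
Proof.
move=> i; apply/negP => ms; have us := i.1.
have xs : x \in [:: x, y & s] by rewrite mem_head.
have ys : y \in [:: x, y & s] by rewrite in_cons mem_head orbT.
have bm : barycentric [:: x, y & s] (fun z => (z == midpoint x y)%:R) (midpoint x y).
  by split; [rewrite sum_indicator | rewrite sum_indicator_scale].
have E := barycentric_unique i bm (barycentric_midpoint us xs ys).
(* The indicator takes the value 0 or 1 at [x], whereas the midpoint has coordinate 1/2 there. *)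
have := E x xs; rewrite /midpoint_coord !eqxx.
have /negPf-> : x != y.
  by move: us => /= /andP[]; rewrite in_cons negb_or => /andP[].
by case: eqP => _ /=; lra.
Qed.

Lemma independent_bisect x y s : independent [:: x, y & s] ->
  independent [:: midpoint x y, x & s].
Proof.
move=> i; have mN := midpoint_notin i; have [us ind] := i.
move: (mN); rewrite !in_cons !negb_or => /and3P[mx my ms].
move: (us); rewrite /= in_cons negb_or => /and3P[/andP[xy xs] ys us'].
split; first by rewrite /= in_cons negb_or mx ms xs.
move=> f; rewrite !big_cons => f0 fv.
(* The same relation in terms of [x], [y] and [s]: the weight of the midpoint is shared equally by
   [x] and [y]. *)
pose g z := if z == x then f x + 2^-1 * f (midpoint x y)
            else if z == y then 2^-1 * f (midpoint x y) else f z.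
have gx : g x = f x + 2^-1 * f (midpoint x y) by rewrite /g eqxx.
have gy : g y = 2^-1 * f (midpoint x y) by rewrite /g eq_sym (negPf xy) eqxx.
have gs : {in s, g =1 f}.
  move=> z zs; rewrite /g; case: eqP => [zx|_]; first by rewrite -zx zs in xs.
  by case: eqP => // zy; rewrite -zy zs in ys.
have g0 : {in [:: x, y & s], forall z, g z = 0}.
  apply: ind; rewrite !big_cons gx gy.
    rewrite big_seq (eq_bigr _ gs) -big_seq -[RHS]f0.
    by rewrite addrACA addrA; lra.
  rewrite big_seq (eq_bigr (fun z => f z *: z)) => [|z /gs->//].
  rewrite -big_seq -[RHS]fv [midpoint x y in RHS]/midpoint scalerA [_ * 2^-1]mulrC.
  rewrite [in RHS]scalerDr scalerDl !addrA; congr (_ + _).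
  by rewrite [f x *: x + _]addrC [RHS]addrAC.
have fm : f (midpoint x y) = 0.
  have := g0 y; rewrite gy in_cons mem_head orbT => /(_ isT)/eqP.
  by rewrite mulf_eq0 invr_eq0 pnatr_eq0 => /eqP.
move=> z; rewrite !in_cons => /or3P[/eqP->//|/eqP->|zs].
  by have := g0 x; rewrite gx fm mulr0 addr0 mem_head => /(_ isT).
by rewrite -gs // g0 // !in_cons zs !orbT.
Qed.

(** With [m] the midpoint, [y = 2 m - x], so a weight [f y] becomes [2 * f y] at [m] and [- f y] at
    [x]. The former is an integer, and the coordinate at [x] stays a half-integer. *)
Lemma good_pair_bisect V x y O N : good_pair V [:: x, y & O] N ->
  good_pair V (x :: O) (midpoint x y :: N).
Proof.
move=> [i sO sN c].
have mN : midpoint x y \notin [:: x, y & O ++ N] by exact: midpoint_notin.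
have p : perm_eq [:: midpoint x y, x & O ++ N] ((x :: O) ++ midpoint x y :: N).
  by rewrite perm_sym -[_ :: N]cat1s perm_catCA.
move: (mN); rewrite !in_cons !negb_or => /and3P[mx my ms].
have /= := i.1; rewrite in_cons negb_or => /and3P[/andP[xy xs] ys us'].
split.
- exact: perm_independent p (independent_bisect i).
- by move=> z; rewrite in_cons => zO; apply: sO; rewrite !in_cons orbCA zO orbT.
- move=> z; rewrite in_cons => /orP[/eqP->|/sN//]; exists x, y.
  by split=> //; apply: sO; rewrite !in_cons eqxx ?orbT.
move=> v /c[f [f1 fv] [fO fN]].
pose g z := if z == midpoint x y then 2 * f y
            else if z == x then f x - f y else f z.
have gm : g (midpoint x y) = 2 * f y by rewrite /g eqxx.
have gx : g x = f x - f y by rewrite /g eq_sym (negPf mx) eqxx.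
have gs : {in O ++ N, g =1 f}.
  move=> z zs; rewrite /g; case: eqP => [zm|_]; first by rewrite -zm zs in ms.
  by case: eqP => // zx; rewrite -zx zs in xs.
exists g.
  apply: (perm_barycentric p); split; rewrite !big_cons gm gx.
    rewrite big_seq (eq_bigr _ gs) -big_seq -[RHS]f1 /= !big_cons.
    by lra.
  rewrite big_seq (eq_bigr (fun z => f z *: z)) => [|z /gs->//].
  rewrite -big_seq fv /= !big_cons /midpoint scalerA [2 * _ * _]mulrAC.
  rewrite divff ?pnatr_eq0 // mul1r scalerDr scalerBl !addrA; congr (_ + _).
  rewrite [f y *: x + _]addrC -!addrA [f x *: x + _ in RHS]addrC addNKr.
  exact: addrC.
split=> z; rewrite in_cons => /orP[/eqP->|zs].
- rewrite gx mulrBr rpredB //; apply: fO; rewrite !in_cons eqxx ?orbT //.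
- by rewrite gs ?mem_cat ?zs //; apply: fO; rewrite !in_cons zs !orbT.
- by rewrite gm; apply: fO; rewrite !in_cons eqxx orbT.
- by rewrite gs ?mem_cat ?zs ?orbT //; exact: fN.
Qed.

(** With a single old vertex left, its coordinate is 1 minus integers, so all coordinates are
    integers. Being nonnegative with sum 1, one of them is 1 and the others vanish. *)
Lemma good_pair_half_point V x N v : good_pair V [:: x] N ->
  half_points V v -> conv_hull (x :: N) v -> v \in x :: N.
Proof.
move=> [i _ _ c] /c[f bf [_ fN]] /(conv_hullP _ i.1)[g g0 bg].
have fg := barycentric_unique i bf bg; have [/= f1 fv] := bf.
have fI : {in x :: N, forall z, f z \is a Num.int}.
  move=> z; rewrite in_cons => /orP[/eqP->|/fN//].
  have -> : f x = 1 - \sum_(z <- N) f z by rewrite -f1 big_cons addrK.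
  by rewrite rpredB ?rpred1 // big_seq rpred_sum.
have f0 : {in x :: N, forall z, 0 <= f z} by move=> z zs; rewrite fg // g0.
have [z zs fz] : exists2 z, z \in x :: N & f z != 0.
  apply/not_exists2P => fz; suff : \sum_(z <- x :: N) f z = 0.
    by rewrite f1 => /eqP; rewrite oner_eq0.
  rewrite big_seq big1 // => z zs; apply/eqP.
  by have [//|/negP] := fz z; rewrite negbK.
have ux := i.1.
have fz1 : 1 <= f z.
  by have := norm_intr_ge1 (fI z zs) fz; rewrite ger0_norm ?f0.
have rest : \sum_(w <- rem z (x :: N)) f w = 1 - f z.
  by rewrite -f1 (perm_big _ (perm_to_rem zs)) big_cons addrC addKr.
have r0 : {in rem z (x :: N), forall w, f w = 0}.
  move=> w wr; apply/eqP; rewrite eq_le f0 ?(mem_rem wr) // andbT.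
  have : \sum_(w <- rem z (x :: N)) f w <= 0 by rewrite rest subr_le0.
  apply: le_trans; rewrite (perm_big _ (perm_to_rem wr)) big_cons lerDl.
  by rewrite big_seq sumr_ge0 // => u /mem_rem/mem_rem/f0.
suff -> : v = z by [].
have s0 : \sum_(w <- rem z (x :: N)) f w = 0 by rewrite big_seq big1.
rewrite fv (perm_big _ (perm_to_rem zs)) big_cons.
have -> : f z = 1 by apply/eqP; rewrite eq_sym -subr_eq0 -rest s0.
rewrite scale1r big_seq big1 => [|w /r0->]; last by rewrite scale0r.
exact: addr0.
Qed.

End AffineGeometry.

(** * Descendants of simplices of types 0 and 1 *)

Lemma perm_swap (A : eqType) (x y : A) (s : seq A) :
  perm_eq [:: x, y & s] [:: y, x & s].
Proof. exact/permPl/(perm_catCA [:: x] [:: y] s). Qed.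

Section Descendants.
Context {R : realType} {m k : nat}.
Local Notation simplex := (nvb_simplex R m k).
Implicit Types (K S T : simplex) (V N O : seq 'rV[R]_m).

Lemma vertE K : vert K = vfirst K :: rcons (inner K) (vlast K) :> seq _.
Proof.
rewrite /vfirst /vlast /inner.
(* The type inhabits ['I_k], which excludes [k = 0]. *)
case: K => v [t tk] /=; case: k v tk => // k'; case/tupleP => x v _.
rewrite (tnth_nth x) (tnth_nth 0) /=; congr (_ :: _).
by rewrite -take_nth ?size_tuple // take_oversize ?size_tuple.
Qed.

Lemma vsetE K v : vset K v = (v \in tval (vert K)).
Proof. by []. Qed.

Lemma vert_inj_cons K a s z : vert K = a :: rcons s z :> seq _ ->
  [/\ vfirst K = a, inner K = s & vlast K = z].
Proof. by rewrite vertE => -[-> /eqP]; rewrite eqseq_rcons => /andP[/eqP-> /eqP->]. Qed.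

Lemma perm_vert K : perm_eq (vert K) [:: vfirst K, vlast K & inner K].
Proof. by rewrite vertE perm_cons perm_rcons. Qed.

Lemma perm_vert_child1 K : perm_eq (vert (child1 K)) [:: vlast K, vmid K & inner K].
Proof.
rewrite /= !perm_cons -[X in perm_eq _ X](cat_take_drop (simplex_type K)).
by rewrite perm_cat2l perm_rev.
Qed.

Lemma independent_child0 K : independent (vert K) -> independent (vert (child0 K)).
Proof.
move=> /(perm_independent (perm_vert K))/independent_bisect.
by apply: perm_independent; exact: perm_swap.
Qed.

Lemma independent_child1 K : independent (vert K) -> independent (vert (child1 K)).
Proof.
move=> /(perm_independent (perm_vert K)) i.
have /independent_bisect : independent [:: vlast K, vfirst K & inner K].
  exact: perm_independent (perm_swap _ _ _) i.
apply: perm_independent; rewrite midpointC perm_sym.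
exact: perm_trans (perm_vert_child1 K) (perm_swap _ _ _).
Qed.

Lemma vset_children K : vset K `<=` vset (child0 K) `|` vset (child1 K).
Proof.
move=> v; rewrite vsetE (perm_mem (perm_vert K)) !in_cons.
move=> /or3P[/eqP->|/eqP->|vi].
- by left; rewrite vsetE mem_head.
- by right; rewrite vsetE mem_head.
- by left; rewrite vsetE !in_cons vi !orbT.
Qed.

Fixpoint descendants n K : set simplex :=
  if n is n'.+1 then descendants n' (child0 K) `|` descendants n' (child1 K)
  else [set K].

Definition uniform_refinement n (P : set simplex) : set simplex :=
  \bigcup_(K in P) descendants n K.

(* For type 0 take Y empty; for type 1 take Y to be the second vertex, which
   stays behind the new vertices and is part of the last bisected edge. *)
Lemma good_pair_descendants V n K a N Y O :
  vert K = a :: N ++ Y ++ O :> seq _ -> (size Y <= 1)%N ->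
  O = [::] \/ simplex_type K = (size N + size Y)%N :> nat ->
  good_pair V (a :: Y ++ O) N -> n = size (Y ++ O) ->
  forall K', descendants n K K' ->
    exists x N', vert K' = x :: N' :> seq _ /\ good_pair V [:: x] N'.
Proof.
elim: n K a N Y O => [|n IH] K a N Y O vK Y1 tK gK nE K' /=.
  move=> ->; have /nilP/eqP YO : size (Y ++ O) == 0 by rewrite -nE.
  move: vK gK; rewrite (eqP YO) cats0 => vK gK; by exists a, N.
case/lastP: O vK tK gK nE => [|O z] vK tK gK nE.
  (* Once [O] is used up, a remaining bisection forces [Y] to be a single vertex [y], and the edge
     from [a] to [y] is cut. *)
  case: Y Y1 vK tK gK nE => [|y []] //= _ vK _ gK [n0].
  rewrite cats1 in vK; have [aE iE zE] := vert_inj_cons vK.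
  have mE : vmid K = midpoint a y by rewrite /vmid aE zE.
  case=> [|].
    apply: (IH _ a (midpoint a y :: N) [::] [::]) => //.
    - by rewrite /= aE mE iE cats0.
    - by left.
    - exact: good_pair_bisect gK.
  (* The type is unknown here, so part of [N] may be reversed; only the order of [N] changes. *)
  apply: (IH _ y (midpoint y a :: take (simplex_type K) N
                    ++ rev (drop (simplex_type K) N)) [::] [::]) => //.
  - by rewrite /= zE mE iE cats0 midpointC.
  - by left.
  apply: (@good_pair_perm _ _ _ [:: y] _ (midpoint y a :: N) _) => //.
    rewrite perm_cons -{1}(cat_take_drop (simplex_type K) N).
    by rewrite perm_cat2l perm_sym perm_rev.
  apply: good_pair_bisect; exact: good_pair_perm (perm_swap _ _ _) _ gK.
have {}tK : simplex_type K = (size N + size Y)%N :> nat.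
  by case: tK => // /(congr1 size); rewrite size_rcons.
have kE : k = (size N + size Y + (size O).+1)%N.
  have := size_tuple (vert K); rewrite vK /= !size_cat size_rcons => -[<-].
  by rewrite addnA.
rewrite -!rcons_cat in vK; have [aE iE zE] := vert_inj_cons vK.
have mE : vmid K = midpoint a z by rewrite /vmid aE zE.
(* The type grows together with [N], and it does not wrap around modulo [k] while old vertices
   remain in [O']. *)
have tS O' : size O' = size O -> O' = [::] \/
    ordS (simplex_type K) = ((size N).+1 + size Y)%N :> nat.
  case: O' => [|w O'] sO; first by left.
  right; rewrite /= tK modn_small //.
  by rewrite kE -sO /= addnS ltnS -[X in (X < _)%N]addn0 ltn_add2l.
have nE' O' : size O' = size O -> n = size (Y ++ O').
  by move: nE; rewrite !size_cat size_rcons addnS => -[->] ->.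
have p : perm_eq (a :: Y ++ rcons O z) [:: a, z & Y ++ O].
  by rewrite perm_cons -rcons_cat perm_rcons.
case=> [|].
  apply: (IH _ a (midpoint a z :: N) Y O) => //.
  - by rewrite /= aE mE iE.
  - exact: tS.
  - by apply: good_pair_bisect; exact: good_pair_perm gK.
  - exact: nE'.
(* As the type is the size of [N ++ Y], the reversal in the second child affects exactly [O]. *)
apply: (IH _ z (midpoint z a :: N) Y (rev O)) => //.
- rewrite /= zE mE iE midpointC tK; congr [:: _, _ & _].
  rewrite catA -size_cat take_size_cat // drop_size_cat //.
  by rewrite catA.
- by apply: tS; rewrite size_rev.
- apply: (@good_pair_perm _ _ _ (z :: Y ++ O) _ (midpoint z a :: N) _) => //.
    by rewrite perm_cons perm_cat2l perm_sym perm_rev.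
  apply: good_pair_bisect; apply: good_pair_perm gK => //.
  exact: perm_trans p (perm_swap _ _ _).
- by apply: nE'; rewrite size_rev.
Qed.

(** Initially [N] is empty, so the type is the size of [Y]: 0 or 1. Each of the [k] bisections
    trades one old vertex for a midpoint, leaving a single old vertex. *)
Lemma descendants_good_pair S K :
  (simplex_type S <= 1)%N -> independent (vert S) -> descendants k S K ->
  exists x N, vert K = x :: N :> seq _ /\ good_pair (vert S) [:: x] N.
Proof.
move=> t1 iS; have gS := good_pair_refl iS.
have sS := size_tuple (vert S).
case E : (tval (vert S)) gS sS => [//|a s] gS [sS].
case tE : (nat_of_ord (simplex_type S)) t1 => [|[|//]] _.
  by apply: (@good_pair_descendants _ _ _ a [::] [::] s) => //; right.
case: s E gS sS => [|y s] E gS sS.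
  by have k1 := ltn_ord (simplex_type S); rewrite tE -sS in k1.
by apply: (@good_pair_descendants _ _ _ a [::] [:: y] s) => //; right.
Qed.

Lemma descendants_half_points S K :
  (simplex_type S <= 1)%N -> independent (vert S) -> descendants k S K ->
  vset K `<=` half_points (vert S).
Proof.
move=> t1 iS /(descendants_good_pair t1 iS)[x [N [vK [_ xS NS _]]]] v.
rewrite vsetE vK in_cons => /orP[/eqP->|/NS//].
by apply: half_points_vertex; apply: xS; rewrite mem_head.
Qed.

Lemma descendants_no_hanging_half_point S K :
  (simplex_type S <= 1)%N -> independent (vert S) -> descendants k S K ->
  half_points (vert S) `&` conv_hull (vert K) `<=` vset K.
Proof.
move=> t1 iS /(descendants_good_pair t1 iS)[x [N [vK gK]]] v [hv].
by rewrite vsetE vK; exact: good_pair_half_point gK hv.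
Qed.

Lemma descendants_conv_hull S K :
  (simplex_type S <= 1)%N -> independent (vert S) -> descendants k S K ->
  conv_hull (vert K) `<=` conv_hull (vert S).
Proof.
move=> t1 iS KS; have hK := descendants_half_points t1 iS KS.
have [x [N [vK [iK _ _ _]]]] := descendants_good_pair t1 iS KS.
apply: conv_hull_sub => [||v vK']; first by case: iS.
  by rewrite vK; case: iK.
by apply: half_points_conv_hull; [case: iS | exact: hK].
Qed.

End Descendants.

(** * The uniform refinement has no hanging nodes *)

Lemma independent_nvb_refinement {R : realType} {d : nat}
    (P Q : set (nvb_simplex R d d)) :
  nvb_refinement P Q -> (forall T, P T -> independent (vert T)) ->
  forall T, Q T -> independent (vert T).
Proof.
move=> PQ iP; elim: PQ => // {}Q T _ iQ QT K [[/iQ//]|[_ -> [->|->]]].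
  exact/independent_child0/iQ.
exact/independent_child1/iQ.
Qed.

(** A node in [K] coming from another element [S'] is a half point of [S'] and lies in the common
    face [F] of [S] and [S']. It is therefore a half point of [F], hence of [S], and so a vertex of
    [K]. *)
Lemma uniform_refinement_no_hanging_node {R : realType} {d : nat}
    (Q : set (nvb_simplex R d d)) :
  (forall T, Q T -> independent (vert T)) ->
  (forall T, Q T -> (simplex_type T <= 1)%N) -> conforming Q ->
  forall K, uniform_refinement d Q K ->
    ~ has_hanging_node (uniform_refinement d Q) K.
Proof.
move=> iQ tQ cQ K [S QS SK] [v [[K' [S' QS' SK'] vK'] vK]]; apply.
apply: (descendants_no_hanging_half_point (tQ _ QS) (iQ _ QS) SK); split=> //.
have hv := descendants_half_points (tQ _ QS') (iQ _ QS') SK' vK'.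
have [->//|SS'] := pselect (S = S').
have vS := descendants_conv_hull (tQ _ QS) (iQ _ QS) SK vK.
have vS' := half_points_conv_hull (iQ _ QS').1 hv.
have [SS0|[F [uF FS FS' FE]]] := cQ _ _ QS QS' SS'.
  by have : set0 v by rewrite -SS0.
have vF : conv_hull F v by rewrite -FE.
have [x [y [xF yF ->]]] := half_points_face (iQ _ QS') uF FS' hv vF.
by exists x, y; split=> //; exact: FS.
Qed.

(** * Counting the missing bisections *)

Section Termination.
Context {R : realType} {d : nat}.
Local Notation simplex := (nvb_simplex R d d).
Implicit Types (K T : simplex) (P Q M : set simplex).

(* Some n bisections turn K into elements of Q. *)
Inductive covered Q : nat -> simplex -> Prop :=
| CoveredLeaf K : Q K -> covered Q 0 K
| CoveredNode a b K : covered Q a (child0 K) -> covered Q b (child1 K) ->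
    covered Q (a + b).+1 K.

Definition coverable Q K : Prop := exists n, covered Q n K.

Lemma coverable_node Q K :
  coverable Q (child0 K) -> coverable Q (child1 K) -> coverable Q K.
Proof. by move=> [a ca] [b cb]; exists (a + b).+1; exact: CoveredNode. Qed.

Lemma coverable_trans P Q K :
  (forall T, P T -> coverable Q T) -> coverable P K -> coverable Q K.
Proof.
move=> PQ [n]; elim=> {n K} [K /PQ//|a b K _ IHa _ IHb].
exact: coverable_node.
Qed.

(** Bisection never loses a vertex: each one passes to a child. *)
Lemma covered_vset Q n K : covered Q n K ->
  forall v, vset K v -> exists2 T, Q T & vset T v.
Proof.
by elim=> {n K} [K QK v|a b K _ IHa _ IHb v /vset_children[/IHa|/IHb]//]; exists K.
Qed.

Lemma nvb_refinement_coverable P Q K :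
  nvb_refinement P Q -> P K -> coverable Q K.
Proof.
move=> PQ PK; elim: PQ => [|{}Q T _ IH QT]; first by exists 0; exact: CoveredLeaf.
apply: coverable_trans IH => K' QK'.
have [->|K'T] := pselect (K' = T); last first.
  by exists 0; apply: CoveredLeaf; left.
apply: coverable_node; exists 0; apply: CoveredLeaf; right; exists T => //.
  by left.
by right.
Qed.

Lemma descendants_coverable Q n K : descendants n K `<=` Q -> coverable Q K.
Proof.
elim: n K => [K KQ|n IH K KQ]; first by exists 0; apply: CoveredLeaf; exact: KQ.
by apply: coverable_node; apply: IH => T KT; apply: KQ; [left|right].
Qed.

Lemma coverable_uniform_refinement Q n K :
  coverable Q K -> coverable (uniform_refinement n Q) K.
Proof.
apply: coverable_trans => T QT; apply: (@descendants_coverable _ n).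
by move=> T' TT'; exists T.
Qed.

(** An element of [Q] has children finer than [Q]; the first of the [n] uniform generations absorbs
    this extra bisection. *)
Lemma coverable_children_uniform_refinement Q n K T : (0 < n)%N ->
  coverable Q K -> children K T -> coverable (uniform_refinement n Q) T.
Proof.
case: n => // n _ [_ [{}K QK|a b {}K Ka Kb]] KT; last first.
  by apply: coverable_uniform_refinement; case: KT => ->; [exists a|exists b].
apply: (@descendants_coverable _ n) => T' TT'; exists K => //.
by case: KT TT' => ->; [left|right].
Qed.

(* N bounds the number of bisections that turn P into a subset of Q. *)
Inductive budget Q : nat -> set simplex -> Prop :=
| BudgetEmpty P : P `<=` set0 -> budget Q 0 P
| BudgetAdd n N K P P' : covered Q n K -> budget Q N P -> P' `<=` K |` P ->
    budget Q (n + N) P'.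

Lemma finite_set_budget Q P : finite_set P ->
  (forall K, P K -> coverable Q K) -> exists N, budget Q N P.
Proof.
move=> /(@finite_seqP {classic simplex})[s ->] {P}.
elim: s => [|K s IH] cs.
  by exists 0; apply: BudgetEmpty => K; rewrite /= in_nil.
have [N bN] : exists N, budget Q N [set` s].
  by apply: IH => T Ts; apply: cs; rewrite /= in_cons Ts orbT.
have [n cn] : coverable Q K by apply: cs; rewrite /= mem_head.
exists (n + N)%N; apply: BudgetAdd cn bN _ => T.
by rewrite /= in_cons => /orP[/eqP->|Ts]; [left|right].
Qed.

(** A marked element is not in [Q], so its covering starts with a bisection, and performing it saves
    one. Intersecting [M] with [P] lets the induction remove elements from [P] while [M] stays
    fixed. *)
Lemma budget_bisect Q M N P : (forall K, M K -> ~ Q K) -> budget Q N P ->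
  exists N', [/\ budget Q N' (bisect P (M `&` P)), (N' <= N)%N
               & M `&` P !=set0 -> (N' < N)%N].
Proof.
move=> MQ; elim=> {N P} [P P0|n N K P P' cK _ [N' [bN' N'N N'lt]] P'P].
  exists 0; split=> //; last by move=> [K [_ /P0]].
  by apply: BudgetEmpty => K [[/P0//]|[T [_ /P0]]].
have [MK|nMK] := pselect (M K).
  case: cK MK P'P => {n K} [K QK /MQ//|a b K ca cb MK P'P].
  (* The two children replace [K], at cost [a + b] instead of [(a + b).+1]. *)
  exists (a + (b + N'))%N; split; last 2 first.
  - by rewrite addnA addSn leqW // leq_add2l.
  - by move=> _; rewrite addnA addSn ltnS leq_add2l.
  apply: (BudgetAdd ca (BudgetAdd cb bN' (@subset_refl _ _))).
  move=> T [[P'T nMT]|[L [ML /P'P[->|PL]]]].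
  - have [TK|PT] := P'P _ P'T; first by case: nMT; rewrite TK in P'T *.
    by right; right; left; split=> // -[MT _]; apply: nMT; split.
  - by case=> ->; [left|right; left].
  - by move=> LT; right; right; right; exists L.
exists (n + N')%N; split; first last.
- move=> [L [ML /P'P[LK|PL]]]; first by rewrite -LK in nMK.
  by rewrite ltn_add2l N'lt //; exists L.
- by rewrite leq_add2l.
apply: BudgetAdd cK bN' _ => T.
move=> [[P'T nMT]|[L [ML /P'P[LK|PL]]]].
- have [->|PT] := P'P _ P'T; first by left.
  by right; left; split=> // -[MT _]; apply: nMT; split.
- by rewrite -LK in nMK.
- by move=> LT; right; right; exists L.
Qed.

Lemma budget_coverable Q N P K : budget Q N P -> P K -> coverable Q K.
Proof.
move=> b; elim: b K => {N P} [P P0 K /P0//|n N L P P' cL _ IH P'P K /P'P[->|/IH//]].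
by exists n.
Qed.

(** All nodes of [P] are nodes of [Q], so a node hanging in [K] would hang in [Q] as well. *)
Lemma budget_no_hanging_node Q N P K :
  (forall T, Q T -> ~ has_hanging_node Q T) -> budget Q N P ->
  has_hanging_node P K -> ~ Q K.
Proof.
move=> hQ bP [v [[T PT vT] vK nvK]] QK; apply: (hQ K QK); exists v; split=> //.
have [n cT] := budget_coverable bP PT.
exact: covered_vset cT _ vT.
Qed.

(** Strong induction on the budget, which drops in every pass with a nonempty marked set. *)
Lemma budget_terminates Q : (forall K, Q K -> ~ has_hanging_node Q K) ->
  forall N P M, budget Q N P -> M `<=` P -> (forall K, M K -> ~ Q K) ->
  iterative_nvb_terminates P M.
Proof.
move=> hQ; elim/ltn_ind => N IH P M bP MP MQ.
have [->|/set0P M0] := eqVneq M set0; first by exists 0.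
have [N' []] := budget_bisect MQ bP.
rewrite (setIidl MP) => bP' _ /(_ M0) N'N.
have [||n nE] := IH _ N'N _ [set T | bisect P M T /\ has_hanging_node (bisect P M) T] bP'.
- by move=> T [].
- by move=> K [_]; exact: budget_no_hanging_node bP'.
- by exists n.+1; rewrite iterSr.
Qed.

End Termination.

(** * The first pass and the subsequent loop *)

Theorem corollary2p18 (R : realType) (d : nat) (Omega : set 'rV[R]_d)
    (T M : set (nvb_simplex R d d)) :
  (2 <= d)%N ->
  domain Omega ->
  triangulation Omega T ->
  conforming T ->
  weakly_compatible T ->
  M `<=` T ->
  iterative_nvb_terminates T M.
Proof.
move=> d2 _ [finT indT _ _] _ [_ [Q [TQ cQ tQ]]] MT.
have iQ := independent_nvb_refinement TQ (fun K TK => affinely_independentP (indT K TK)).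
have cT K : T K -> coverable Q K by exact: nvb_refinement_coverable.
have hQ := uniform_refinement_no_hanging_node iQ tQ cQ.
have finM := sub_finite_set MT finT.
(* The first pass is treated apart, since the initial marking is arbitrary. From then on marked
   elements contain hanging nodes and so lie outside the uniform refinement. *)
have [N bN] : exists N, budget (uniform_refinement d Q) N (bisect T M).
  apply: finite_set_budget.
    rewrite /bisect finite_setU; split; first exact: finite_setD.
    by apply: bigcup_finite => // K _; rewrite finite_setU; split; exact: finite_set1.
  move=> K [[TK _]|[L /MT TL LK]].
    exact/coverable_uniform_refinement/cT.
  apply: coverable_children_uniform_refinement LK; first exact: ltn_trans d2.
  exact: cT.
have [||n nE] := budget_terminates hQ (M := [set K | bisect T M K /\
    has_hanging_node (bisect T M) K]) bN.
- by move=> K [].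
- by move=> K [_]; exact: budget_no_hanging_node bN.
by exists n.+1; rewrite iterSr.
Qed.
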